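(* Let $T(x)=1+\sum_{n\ge1}t_nx^n$ be the cluster generating function for the consecutive pattern $13425$ (defined in the context). Then \[T(x) = \frac{1+2x-F(x)}{1+x-F(x)},\qquad F(x) = \frac{2}{\sqrt{3x}}\sinh\!\left(\frac13 \operatorname{arcsinh}\!\left(\frac{3\sqrt{3x^3}}{2}\right)\right),\] where $F(x)=x+O(x^4)$ is a power series in $x$. Moreover $T(x)$ is an algebraic function, being a root of a cubic polynomial with coefficients in $\mathbb{Z}[x]$.
   Context: For a consecutive pattern $\sigma$ of length $m$ (here $\sigma=13425$, $m=5$): an occurrence of $\sigma$ in a permutation is a block of $m$ consecutive positions whose entries are in the same relative order as $\sigma$. A $k$-cluster of length $n\ge m$ is a permutation of $\{1,\dots,n\}$ containing precisely $k$ occurrences of $\sigma$, such that every entry belongs to at least one occurrence and any two successive occurrences overlap in at least one position. Let $s_{n,k}$ be the number of $k$-clusters of length $n$, with $s_{1,0}=1$ and $s_{n,k}=0$ otherwise for $n<m$; set $t_n=\sum_k(-1)^ks_{n,k}$ and $T(x)=1+\sum_{n\ge1}t_nx^n$. *)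

(* Defs.v *)
From Stdlib Require Import Reals ZArith.
From Coquelicot Require Import Coquelicot.
From mathcomp Require Import all_boot all_fingroup.

Set Implicit Arguments.
Unset Strict Implicit.
Unset Printing Implicit Defensive.

Definition sigma13425 : seq nat := [:: 1; 3; 4; 2; 5]%N.
Definition pat_len : nat := 5.

(* values of a permutation p of {0,...,n-1}, read as a word of length n
   (the shift by one w.r.t. {1,...,n} is irrelevant for relative order) *)
Definition pval (n : nat) (p : 'S_n) (j : nat) : nat :=
  nth 0%N [seq val (p i) | i <- enum 'I_n] j.

Definition is_occ (n : nat) (p : 'S_n) (i : nat) : bool :=
  ((i + pat_len <= n)%N &&
   [forall a : 'I_pat_len, forall b : 'I_pat_len,
      (pval p (i + a) < pval p (i + b))%N ==
      (nth 0 sigma13425 a < nth 0 sigma13425 b)%N]).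

Definition occs (n : nat) (p : 'S_n) : seq nat :=
  [seq i <- iota 0 n | is_occ p i].

Definition is_cluster (n : nat) (p : 'S_n) (k : nat) : bool :=
  [&& size (occs p) == k,
      [forall j : 'I_n, has (fun i => (i <= j < i + pat_len)%N) (occs p)]
    & sorted (fun i i' => (i' < i + pat_len)%N) (occs p)].

Definition s_nk (n k : nat) : nat :=
  if (n < pat_len)%N then ((n == 1%N) && (k == 0%N) : nat)
  else #|[set p : 'S_n | is_cluster p k]|.

Open Scope R_scope.

(* t_n = sum_k (-1)^k s_{n,k}  (s_{n,k} = 0 for k > n) *)
Definition t_n (n : nat) : R :=
  sum_f_R0 (fun k => (-1) ^ k * INR (s_nk n k)) n.

Definition Tcoef (n : nat) : R := if n is 0%N then 1 else t_n n.

Definition Tval (x : R) : R := Series (fun n => Tcoef n * x ^ n).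

Definition Ffun (x : R) : R :=
  2 / sqrt (3 * x) * sinh (/ 3 * arcsinh (3 * sqrt (3 * x ^ 3) / 2)).

(* Main.v *)
(* Write [F] for [Ffun].  The triple-angle formula for [sinh] gives
   [x F^3 + F = x].

   Two occurrences of 13425 can only overlap in one or two positions, so the
   occurrences of a cluster start at [0 = o_0 < o_1 < ... = n - 5] with
   consecutive differences 3 or 4.  Read the positions of a cluster by
   increasing value.  An occurrence at [o] forces the reading order
   [o, o+3, o+1, o+2, o+4].  Hence at any time the next position is either the
   second smallest entry of an occurrence of which only the smallest entry has
   been read (letter [true]), or the leftmost unread position (letter [false]);
   the resulting binary word determines the cluster and has one [true] per
   occurrence.  Inside a maximal
   run of occurrences at distance 3 the words are lattice paths with steps [+2]
   and [-1] that stay nonnegative; a [false] at height 0 closes the run, and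
   then either the cluster ends or a new run starts with a [true].

   The signed generating functions of paths from all states satisfy a linear
   system that contracts for small [x].  It is solved explicitly by
   [1 / (1 + x - F)] and [F^(h+1) / (1 + x - F)], so the series converge to
   these values without any prior estimate on the number of clusters.  The
   expansion of [F] itself comes from the same system without the closing step. *)
Require Import Defs.
From Stdlib Require Import Reals ZArith Lra.
From Coquelicot Require Import Coquelicot.
From mathcomp Require Import all_boot all_fingroup.
From mathcomp Require Import zify.
Open Scope R_scope.

Set Implicit Arguments.
Unset Strict Implicit.
Unset Printing Implicit Defensive.

(** * Signed generating functions of walks *)

(** An [up] step carries the sign -1; in the walks of clusters it stands for one occurrence. The
    weight [u] is taken at the final state. *)
Fixpoint walks (A : Type) (up : A -> A) (down : A -> option A) (u : A -> R)
    (n : nat) (a : A) : R :=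
  if n is n'.+1
  then oapp (walks up down u n') 0 (down a) - walks up down u n' (up a)
  else u a.

(** Splitting off the first step shows that the partial sums obey, with a lag of one term, the
    linear system imposed on [V] in [is_series_walks]. *)
Lemma sum_walks (A : Type) (up : A -> A) (down : A -> option A) (u : A -> R)
    (x : R) (N : nat) (a : A) :
  let S b := sum_n (fun n => walks up down u n b * x ^ n) in
  S a N.+1 = u a + x * (oapp (S^~ N) 0 (down a) - S (up a) N).
Proof.
move=> S; rewrite /S; elim: N => [|N IH].
  rewrite sum_Sn !sum_O /plus /=.
  by case: (down a) => [b|] /=; rewrite ?sum_O /=; ring.
rewrite sum_Sn IH (sum_Sn _ N) /plus [walks _ _ _ N.+2 a]/= -[x ^ N.+2]/(x * x ^ N.+1).
case: (down a) => [b|] /=; last by ring.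
by rewrite (sum_Sn _ N) /plus /=; ring.
Qed.

(* The error after [N + 1] terms, maximised over all states, is multiplied by
   at most [2 * x] when [N] increases. *)
Lemma is_series_walks (A : Type) (up : A -> A) (down : A -> option A)
    (u V : A -> R) (x B : R) (hx : 0 < x < / 2)
    (hB : forall a, Rabs (V a) <= B)
    (hV : forall a, V a = u a + x * (oapp V 0 (down a) - V (up a))) (a : A) :
  is_series (fun n => walks up down u n a * x ^ n) (V a).
Proof.
have hB0 : 0 <= B by apply: Rle_trans (hB a); apply: Rabs_pos.
have err N b :
    Rabs (sum_n (fun n => walks up down u n b * x ^ n) N - V b)
      <= B * (2 * x) ^ N.+1.
  elim: N b => [|N IH] b.
    rewrite sum_O /= (hV b).
    have -> : u b * 1 - (u b + x * (oapp V 0 (down b) - V (up b)))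
              = x * (V (up b) - oapp V 0 (down b)) by ring.
    rewrite Rabs_mult (Rabs_pos_eq x); last lra.
    have h1 := hB (up b).
    have h2 : Rabs (oapp V 0 (down b)) <= B.
      by case: (down b) => [c|] //=; rewrite Rabs_R0.
    have h3 := Rabs_triang (V (up b)) (- oapp V 0 (down b)).
    rewrite Rabs_Ropp in h3.
    have : x * Rabs (V (up b) - oapp V 0 (down b)) <= x * (2 * B).
      by apply: Rmult_le_compat_l; [lra | rewrite /Rminus; lra].
    lra.
  have -> : sum_n (fun n => walks up down u n b * x ^ n) N.+1 - V b
    = x * (oapp (fun c => sum_n (fun n => walks up down u n c * x ^ n) N - V c) 0 (down b)
       - (sum_n (fun n => walks up down u n (up b) * x ^ n) N - V (up b))).
    rewrite sum_walks (hV b).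
    by case: (down b) => [c|] /=; ring.
  set E := B * (2 * x) ^ N.+1.
  have h1 : Rabs (oapp (fun c => sum_n (fun n => walks up down u n c * x ^ n) N - V c)
                    0 (down b)) <= E.
    case: (down b) => [c|] /=; first exact: IH.
    rewrite Rabs_R0; apply: Rmult_le_pos => //; apply: pow_le; lra.
  have h2 := IH (up b); rewrite -/E in h2.
  rewrite Rabs_mult (Rabs_pos_eq x); last lra.
  have -> : B * (2 * x) ^ N.+2 = x * (E + E) by rewrite /E /=; ring.
  apply: Rmult_le_compat_l; first lra.
  apply: Rle_trans (Rabs_triang _ _) _; rewrite Rabs_Ropp; lra.
have lim0 : is_lim_seq
    (fun N => sum_n (fun n => walks up down u n a * x ^ n) N - V a) 0.
  apply/is_lim_seq_abs_0.
  apply: (is_lim_seq_le_le (fun _ => 0) _ (fun N => B * (2 * x) ^ N.+1)).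
  - by move=> N; split; [apply: Rabs_pos | apply: err].
  - exact: is_lim_seq_const.
  - rewrite -(Rmult_0_r B).
    apply: (is_lim_seq_scal_l _ B 0).
    apply/(is_lim_seq_incr_1 (fun N => (2 * x) ^ N)).
    by apply: is_lim_seq_geom; rewrite Rabs_pos_eq; lra.
suff : is_lim_seq (sum_n (fun n => walks up down u n a * x ^ n)) (0 + V a).
  by rewrite Rplus_0_l.
apply: (is_lim_seq_ext (fun N =>
  (sum_n (fun n => walks up down u n a * x ^ n) N - V a) + V a)).
  by move=> N; ring.
by apply: is_lim_seq_plus'; [exact: lim0 | exact: is_lim_seq_const].
Qed.

(** * The function [Ffun] and its power series *)

Lemma Ffun_cubic (x : R) (hx : 0 < x) : x * Ffun x ^ 3 + Ffun x = x.
Proof.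
have sq : sqrt (3 * x) * sqrt (3 * x) = 3 * x by apply: sqrt_sqrt; lra.
have s0 : 0 < sqrt (3 * x) by apply: sqrt_lt_R0; lra.
have hs : sqrt (3 * x ^ 3) = x * sqrt (3 * x).
  have -> : 3 * x ^ 3 = (x * x) * (3 * x) by ring.
  by rewrite sqrt_mult_alt; [rewrite sqrt_square //; lra | nra].
rewrite /Ffun hs; set th := arcsinh _; set s := sqrt (3 * x) in sq s0 *.
have hth : sinh th = 3 * (x * s) / 2 by apply: sinh_arcsinh.
have tri y : sinh (3 * y) = 4 * sinh y ^ 3 + 3 * sinh y.
  rewrite /sinh.
  have -> : 3 * y = y + y + y by ring.
  have -> : - (y + y + y) = - y + - y + - y by ring.
  have e1 : exp y * exp (- y) = 1 by rewrite -exp_plus Rplus_opp_r exp_0.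
  rewrite !exp_plus; move: (exp y) (exp (- y)) e1 => a b e1.
  have -> : b = / a by field_simplify_eq; nra.
  by field; nra.
have := tri (/ 3 * th); have -> : 3 * (/ 3 * th) = th by field.
rewrite hth; move: (sinh _) => S hS.
(* With [F = 2 / s * S] and [s * s = 3 * x], the cubic times [s] is two thirds of the triple-angle
   identity [hS]. *)
have : s * (x * (2 / s * S) ^ 3 + 2 / s * S) = s * x; last first.
  by move/Rmult_eq_reg_l; apply; lra.
have -> : s * (x * (2 / s * S) ^ 3 + 2 / s * S) = 8 * x * S ^ 3 / (s * s) + 2 * S.
  by field; lra.
by rewrite sq; field_simplify_eq; nra.
Qed.

Lemma Ffun_gt0 (x : R) (hx : 0 < x) : 0 < Ffun x.
Proof.
have s0 : 0 < sqrt (3 * x) by apply: sqrt_lt_R0; lra.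
have s1 : 0 < sqrt (3 * x ^ 3).
  by apply: sqrt_lt_R0; apply: Rmult_lt_0_compat; [lra | apply: pow_lt].
rewrite /Ffun; apply: Rmult_lt_0_compat.
  by apply: Rdiv_lt_0_compat; lra.
rewrite -sinh_0; apply: sinh_lt; apply: Rmult_lt_0_compat; first lra.
by rewrite -arcsinh_0; apply: arcsinh_lt; lra.
Qed.

Lemma Ffun_le (x : R) (hx : 0 < x) : Ffun x <= x.
Proof.
have h1 := Ffun_cubic hx; have h2 := Ffun_gt0 hx.
have : 0 < x * Ffun x ^ 3 by apply: Rmult_lt_0_compat => //; apply: pow_lt.
lra.
Qed.

(** [F] is the signed generating function of first passages one level down: a nonnegative walk from
    0 back to 0 with steps +2 and -1, then one closing down step, which shifts the index by one. *)
Definition Fcoef (n : nat) : R :=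
  if n is n'.+1
  then walks (fun h => h.+2) (fun h => if h is h'.+1 then Some h' else None)
         (fun h => if h is 0%N then 1 else 0) n' 0%N
  else 0.

Lemma is_series_Fcoef (x : R) (hx : 0 < x < / 2) :
  is_series (fun n => Fcoef n * x ^ n) (Ffun x).
Proof.
have [h1 h2 h3] : [/\ 0 < Ffun x, Ffun x <= x & x * Ffun x ^ 3 + Ffun x = x].
  by split; [apply: Ffun_gt0 | apply: Ffun_le | apply: Ffun_cubic]; lra.
move: (Ffun x) h1 h2 h3 => F h1 h2 h3.
apply: is_series_decr_1; rewrite /Fcoef /plus /opp /= Rmult_0_l Ropp_0 Rplus_0_r.
set D := fun h : nat => if h is h'.+1 then Some h' else None.
(* A walk from height [h] to 0 consists of [h] first passages, each contributing [F], and a walk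
   from 0 to 0, contributing [F / x]. *)
pose V h := F ^ h.+1 / x.
have hV := @is_series_walks nat (fun h => h.+2) D
  (fun h => if h is 0%N then 1 else 0) V x 1 hx.
have -> : F = x * V 0%N by rewrite /V; field; lra.
apply: (is_series_ext (fun n => scal x (walks (fun h => h.+2) D
  (fun h => if h is 0%N then 1 else 0) n 0%N * x ^ n))).
  by move=> n; rewrite /scal /= /mult /=; ring.
apply: is_series_scal; apply: hV => [h|[|h]] /=.
- have F1 : 0 <= F ^ h <= 1.
    split; first by apply: pow_le; lra.
    by rewrite -(pow1 h); apply: pow_incr; lra.
  have h0 : 0 <= F * / x <= 1.
    split; first by apply: Rle_mult_inv_pos; lra.
    by apply/Rle_div_l; lra.
  rewrite /V /=; rewrite Rabs_pos_eq; nra.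
- rewrite /V /=; field_simplify_eq; [nra | lra].
- rewrite /V /=.
  have -> : F * (F * F ^ h) / x = (x * F ^ 3 + F) * (F * F ^ h) / x - F ^ 4 * F ^ h.
    by field; lra.
  by rewrite h3; field; lra.
Qed.

(* State [None]: between two runs of occurrences; [Some h]: inside a run, at
   height [h]. *)
Definition rise (m : option nat) : option nat :=
  if m is Some h then Some h.+2 else Some 2%N.

Definition fall (m : option nat) : option (option nat) :=
  match m with
  | None => None
  | Some 0%N => Some None
  | Some h.+1 => Some (Some h)
  end.

Definition cluster_walks : nat -> option nat -> R :=
  walks rise fall (fun m => if m is None then 1 else 0).

(** * Binary words and their decoding into reading orders *)

Section Combinatorics.
Local Open Scope nat_scope.

Fixpoint accepted (m : option nat) (w : seq bool) : bool :=
  match w with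
  | [::] => ~~ isSome m
  | true :: w' => accepted (rise m) w'
  | false :: w' => oapp (accepted^~ w') false (fall m)
  end.

Fixpoint words (n : nat) (m : option nat) : seq (seq bool) :=
  if n is n'.+1
  then map (cons true) (words n' (rise m))
         ++ oapp (fun m' => map (cons false) (words n' m')) [::] (fall m)
  else if m is None then [:: [::]] else [::].

Lemma mem_map_cons (T : eqType) (a b : T) (w : seq T) (s : seq (seq T)) :
  (b :: w \in map (cons a) s) = (b == a) && (w \in s).
Proof.
apply/mapP/andP => [[u us [-> ->]]|[/eqP -> ws]]; first by rewrite eqxx.
by exists w.
Qed.

Lemma mem_words (n : nat) (m : option nat) (w : seq bool) :
  (w \in words n m) = (size w == n) && accepted m w.
Proof.
elim: n m w => [|n IH] m w /=.
  by case: m w => [h|] [|b w].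
rewrite mem_cat; case: w => [|b w] /=.
  apply/negP => /orP[/mapP[u _ //]|].
  by case: (fall m) => [m'|] //= /mapP[].
rewrite mem_map_cons IH eqSS; case: b => /=; case: (fall m) => [m'|] /=;
  by rewrite ?mem_map_cons ?in_nil ?orbF ?andbF //= IH.
Qed.

Lemma uniq_words (n : nat) (m : option nat) : uniq (words n m).
Proof.
have inj_cons b : injective (cons b : seq bool -> seq bool) by move=> ? ? [].
elim: n m => [|n IH] m /=; first by case: m.
rewrite cat_uniq map_inj_uniq // IH /=; case: (fall m) => [m'|] //=.
rewrite map_inj_uniq // IH andbT; apply/hasPn => w /mapP[u _ ->].
by rewrite mem_map_cons.
Qed.

(* In state [(c, m)] the leftmost unread position is [c] and the next
   occurrence to open would start at [f = c + width m - 1].  The positions already read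
   are those before [c] and those up to [f] congruent to [f] modulo 3, see
   [seen]; the height is the number of unread positions before [f]. *)
Definition width (m : option nat) : nat := if m is Some h then h + uphalf h else 0.
(** Inside a run the value is 2 exactly when [c + 1] is already read and has to be skipped. *)
Definition advance (m : option nat) : nat := if m is Some h then (odd h).+1 else 1.

Fixpoint decode (c : nat) (m : option nat) (w : seq bool) : seq nat :=
  match w with
  | [::] => [::]
  | true :: w' => (c + width m).+2 :: decode c (rise m) w'
  | false :: w' => c :: decode (c + advance m) (odflt None (fall m)) w'
  end.

Fixpoint starts (c : nat) (m : option nat) (w : seq bool) : seq nat :=
  match w with
  | [::] => [::]
  | true :: w' => (c + width m).-1 :: starts c (rise m) w'
  | false :: w' => starts (c + advance m) (odflt None (fall m)) w'
  end.

(** Beyond [f] the truncated subtraction gives 0, so these positions count as unread. *)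
Definition seen (c : nat) (m : option nat) (x : nat) : bool :=
  (x < c) || ((c + width m - x) %% 3 == 1).

Definition gap (a b : nat) : bool := (b == a + 3) || (b == a + 4).

Lemma width_rise (m : option nat) : width (rise m) = width m + 3.
Proof. case: m => [h|] //=; lia. Qed.

Lemma width_fall (h : nat) : advance (Some h.+1) + width (Some h) = width (Some h.+1).
Proof. rewrite /=; lia. Qed.

Lemma size_starts (c : nat) (m : option nat) (w : seq bool) :
  size (starts c m w) = count id w.
Proof. by elim: w c m => [|[] w IH] c m //=; rewrite IH. Qed.

Lemma size_decode (c : nat) (m : option nat) (w : seq bool) :
  size (decode c m w) = size w.
Proof. by elim: w c m => [|[] w IH] c m //=; rewrite IH. Qed.

(** The first position read is [c] after [false] and lies beyond [c] after [true], so it reveals the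
    letter. *)
Lemma decode_inj (c : nat) (m : option nat) (w w' : seq bool) :
  decode c m w = decode c m w' -> w = w'.
Proof.
elim: w w' c m => [|b w IH] [|b' w'] c m //=; [by case: b' | by case: b |].
by case: b b' => [] [] //= [] => [/IH ->|? _|? _|/IH ->] //; lia.
Qed.

Lemma starts_ge (c : nat) (m : option nat) (w : seq bool) (o : nat) :
  o \in starts c m w -> c + width m <= o.+1.
Proof.
elim: w c m => [|[] w IH] c m //=.
  rewrite inE => /orP[|/IH]; rewrite ?width_rise; lia.
move/IH; case: m => [[|h]|] /=; lia.
Qed.

Lemma gap_path_last (a : nat) (s : seq nat) : path gap a s -> a <= last a s.
Proof.
elim: s a => [|b s IH] a //= /andP[ab /IH]; move: ab; rewrite /gap; lia.
Qed.

Lemma seen_rise (c : nat) (m : option nat) (x : nat) :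
  seen c (rise m) x = seen c m x || (x == (c + width m).+2).
Proof. rewrite /seen width_rise; lia. Qed.

Lemma seen_fall (c : nat) (m m' : option nat) (x : nat) : fall m = Some m' ->
  seen (c + advance m) m' x = seen c m x || (x == c).
Proof.
case: m => [[|h]|] //= [<-]; rewrite /seen /=; last by lia.
lia.
Qed.

(** Inside a run, [o = f - 3] is the occurrence opened last and [s] continues the chain from it.
    Between runs, either the cluster is complete or the next occurrence starts at [c - 1]. *)
Definition chain_spec (c : nat) (m : option nat) (s : seq nat) (N : nat) : Prop :=
  if isSome m
  then exists o, [/\ o + 4 = c + width m, path gap o s & last o s + 5 = N]
  else s = [::] /\ c = N \/
       exists o s', [/\ o.+1 = c, s = o :: s', path gap o s' & last o s' + 5 = N].

(** Induction on the word; the length [N] is existential because only the end of the word fixes it.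
    The bound [3 < c + width m] makes [c + width m - 4], the start opened last, a true
    difference. *)
Lemma decode_spec (c : nat) (m : option nat) (w : seq bool) :
  0 < c -> (isSome m -> 3 < c + width m) -> accepted m w ->
  exists N, [/\ uniq (decode c m w),
    forall x, x \in decode c m w = (x < N) && ~~ seen c m x
    & chain_spec c m (starts c m w) N].
Proof.
elim: w c m => [|b w IH] c m c0 m0 /=.
  case: m m0 => // _ _; exists c; split=> [//|x|]; last by left.
  by rewrite in_nil /seen /=; lia.
case: b => [|].
  move=> acc; have [|N [uD mD cD]] := IH c (rise m) c0 _ acc.
    by move=> _; rewrite width_rise; lia.
  have {cD} : exists o, [/\ o + 4 = c + width (rise m), path gap o (starts c (rise m) w)
                 & last o (starts c (rise m) w) + 5 = N] by move: cD; case: (m).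
  rewrite width_rise => cD; exists N; split.
  - by rewrite /= uD andbT mD seen_rise eqxx orbT andbF.
  - move=> x; rewrite inE mD seen_rise.
    have : (c + width m).+2 < N.
      by case: cD => o [h1 /gap_path_last h2 h3]; lia.
    have : seen c m (c + width m).+2 = false by rewrite /seen; lia.
    by case: eqP => [->|] /=; [move=> -> -> | rewrite orbF].
  - case: cD => o [h1 h2 h3].
    have eo : (c + width m).-1 = o by lia.
    rewrite eo /chain_spec; case: ifP m0 => [_ /(_ isT) m0|]; last first.
      case: m h1 h2 h3 {uD mD acc eo} => //= h1 h2 h3 _ _; right.
      by exists o, (starts c (Some 2) w); split=> //; lia.
    exists (o - 3); split=> //=; first lia.
    by rewrite h2 andbT /gap; lia.
case dm: (fall m) => [m'|] //= acc.
have [||N [uD mD cD]] := IH (c + advance m) m' _ _ acc.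
- lia.
- by case: m m0 dm => [[|h]|] //= m0 [<-] _; have := m0 isT; rewrite /=; lia.
exists N; split.
- by rewrite /= uD andbT mD (seen_fall _ _ dm) eqxx orbT andbF.
- move=> x; rewrite inE mD (seen_fall _ _ dm).
  have : c < N.
    move: dm cD; case: m {m0 uD mD acc} => [[|h]|] //= [<-] /=.
      by case=> [[_ <-]|[o [s' [h1 _ /gap_path_last h2 <-]]]]; lia.
    by case=> o [h1 /gap_path_last h2 h3]; lia.
  have : seen c m c = false.
    by case: m dm {m0 mD uD cD} => [h|] // _; rewrite /seen /=; lia.
  by case: eqP => [->|] /=; [move=> -> -> | rewrite orbF].
- move: dm m0 cD; case: m {uD mD acc} => [[|h]|] //= [<-] /= m0; last first.
    by case=> o [h1 h2 h3]; exists o; split=> //; move: h1 => /=; lia.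
  (* A [false] at height 0 reads the last entry of the occurrence at [c - 4]. If a new run follows,
     it starts at [c], whence the gap 4. *)
  case=> [[-> <-]|[o [s' [h1 -> h2 h3]]]].
    by exists (c - 4); split=> //=; have := m0 isT; lia.
  exists (o - 4); split=> /=; first by have := m0 isT; lia.
    by rewrite h2 andbT /gap; have := m0 isT; lia.
  by [].
Qed.

(** * Decoded orders respect the pattern *)

(** Consecutive pairs of the reading order 0, 3, 1, 2, 4; the other comparisons follow by
    transitivity. *)
Definition occ_steps : seq (nat * nat) := [:: (0, 3); (3, 1); (1, 2); (2, 4)].

Lemma occ_stepsP (d : nat * nat) : d \in occ_steps ->
  [\/ d = (0, 3), d = (3, 1), d = (1, 2) | d = (2, 4)].
Proof.
rewrite /occ_steps !inE => /or4P[] /eqP ->;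
  by [constructor 1 | constructor 2 | constructor 3 | constructor 4].
Qed.

(* [precedes D a b] also holds when [a] or [b] is missing from [D]: elements
   missing from the word still to be read have been read before, and nothing
   is required when [b] has been read. *)
Definition precedes (D : seq nat) (a b : nat) : bool :=
  [|| b \notin D, a \notin D | index a D < index b D].

Lemma precedes_cons (D : seq nat) (x a b : nat) : a != b ->
  (b = x -> a \notin D) -> precedes D a b -> precedes (x :: D) a b.
Proof.
rewrite /precedes !inE /= !(eq_sym x) => ab hb.
case: (eqVneq b x) => [bx|nb] /=.
  by rewrite -bx (negbTE ab) (hb bx) ?orbT.
by case: (eqVneq a x) => [ax|na] //=; rewrite ?orbT.
Qed.

(** This covers the occurrences opened so far: those entirely read, and those of the current run,
    which start at most at [f - 3] and are congruent to [f] modulo 3. *)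
Definition past_start (c : nat) (m : option nat) (o : nat) : bool :=
  (o + 4 < c) || (o + 3 < c + width m) && ((c + width m - o) %% 3 == 1).

(** An occurrence is either open or starts later, and reading a letter preserves this alternative.
    Residues modulo 3 then show that [o + d.1] has been read by the time [o + d.2] is. *)
Lemma decode_precedes (c : nat) (m : option nat) (w : seq bool) (o : nat)
    (d : nat * nat) :
  0 < c -> (isSome m -> 3 < c + width m) -> accepted m w ->
  past_start c m o || (o \in starts c m w) -> d \in occ_steps ->
  precedes (decode c m w) (o + d.1) (o + d.2).
Proof.
move=> c0 m0 acc ho hd; have {hd} hd := occ_stepsP hd.
have dd : o + d.1 != o + d.2 by case: hd => -> /=; lia.
elim: w c m c0 m0 acc ho => [|b w IH] c m c0 m0 //= acc ho.
case: b acc ho => [|] /= acc ho.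
  have m1 : isSome (rise m) -> 3 < c + width (rise m) by rewrite width_rise; lia.
  have ho' : past_start c (rise m) o || (o \in starts c (rise m) w).
    move: ho; rewrite inE /past_start width_rise.
    by case: (o \in _); rewrite ?orbT ?orbF //; lia.
  have [N [_ mD _]] := decode_spec c0 m1 acc.
  apply: precedes_cons => //; last exact: IH.
  move=> e; rewrite mD negb_and negbK; apply/orP; right; rewrite /seen width_rise.
  case/orP: ho' => [|/starts_ge]; rewrite /past_start width_rise;
    by case: hd e => -> /=; lia.
case dm: (fall m) acc ho => [m'|] //= acc ho.
have c1 : 0 < c + advance m by lia.
have m1 : isSome m' -> 3 < c + advance m + width m'.
  by case: m m0 dm {acc ho c1} => [[|h]|] //= m0 [<-] _; have := m0 isT; rewrite /=; lia.
have ho' : past_start (c + advance m) m' o || (o \in starts (c + advance m) m' w).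
  case/orP: ho => [ho|->]; last by rewrite orbT.
  apply/orP; left; move: ho; rewrite /past_start.
  by case: m dm {m0 c1 m1 acc} => [[|h]|] //= [<-] /=; lia.
have [N [_ mD _]] := decode_spec c1 m1 acc.
apply: precedes_cons => //; last exact: IH.
move=> e; rewrite mD negb_and negbK; apply/orP; right.
rewrite (seen_fall _ _ dm) /seen.
case/orP: ho => [|/starts_ge].
  rewrite /past_start; case: m dm {m0 c1 m1 acc mD ho'} => [[|h]|] //= _;
    by case: hd e => -> /=; lia.
by case: m dm {m0 c1 m1 acc mD ho'} => [[|h]|] //= [<-] /=; case: hd e => -> /=; lia.
Qed.

Definition occ_at (v : nat -> nat) (o : nat) : bool :=
  all (fun d => v (o + d.1) < v (o + d.2)) occ_steps.

Lemma occ_atE (v : nat -> nat) (o : nat) :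
  occ_at v o = [&& v o < v o.+3, v o.+3 < v o.+1, v o.+1 < v o.+2 & v o.+2 < v o.+4].
Proof. by rewrite /occ_at /= !addnS !addn0 andbT. Qed.

(** Under a shift by 1 or 2, the second occurrence makes the entry at [o + 2] smaller than the one
    at [o + 3], while the first makes it larger. *)
Lemma occ_at_far (v : nat -> nat) (o o' : nat) :
  occ_at v o -> occ_at v o' -> o < o' -> o + 3 <= o'.
Proof.
rewrite !occ_atE => h h' lt; rewrite leqNgt; apply/negP => lt'.
have [e|e] : o' = o.+1 \/ o' = o.+2 by lia.
  by move: h h'; rewrite e => /and4P[? ? ? ?] /and4P[]; lia.
by move: h h'; rewrite e => /and4P[? ? ? ?] /and4P[]; lia.
Qed.

(** * Reading a chain of occurrences by increasing value *)

Section ReadingWord.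
Variables (n : nat) (v : nat -> nat) (O : pred nat).
Hypothesis occO : forall o, O o -> occ_at v o /\ o + 5 <= n.
Hypothesis nextO : forall o, O o -> [|| o + 5 == n, O o.+3 | O o.+4].

(** Positions beyond [o + 4] are reached through the next occurrence, whose first entry belongs to
    this one. *)
Lemma start_min (o x : nat) : O o -> o < x < n -> v o < v x.
Proof.
have [k] := ubnP (n - o); elim: k o => // k IH o ko oO /andP[ox xn].
have [] := occO oO; rewrite occ_atE => /and4P[o1 o2 o3 o4] on.
have [x4|x4] := leqP x o.+4.
  have [e|[e|[e|e]]] : x = o.+1 \/ x = o.+2 \/ x = o.+3 \/ x = o.+4 by lia.
  - by rewrite e; lia.
  - by rewrite e; lia.
  - by rewrite e; lia.
  - by rewrite e; lia.
case/or3P: (nextO oO) => [/eqP e|h|h]; first lia.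
  have := IH o.+3 _ h; lia.
have := IH o.+4 _ h; lia.
Qed.

Lemma second_min (o x : nat) : O o -> o < x < n -> x != o.+3 -> v o.+3 < v x.
Proof.
move=> oO xo x3; have [] := occO oO; rewrite occ_atE => /and4P[o1 o2 o3 o4] on.
have [e|[e|[e|e]]] : x = o.+1 \/ x = o.+2 \/ x = o.+4 \/ o.+4 < x by lia.
- by rewrite e; lia.
- by rewrite e; lia.
- by rewrite e; lia.
case/or3P: (nextO oO) => [/eqP|h|h]; first lia.
  by apply: start_min; lia.
by have := @start_min _ x h; lia.
Qed.

Hypothesis O0 : O 0.

(* The last clause: the occurrences of the current run whose last two entries
   may still be unread. *)
Definition read_state (c : nat) (m : option nat) : Prop :=
  if isSome m
  then exists o, [/\ o + 4 = c + width m, O o &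
         forall o', c <= o' + 2 -> (c + width m - o') %% 3 = 1 ->
           o'.+1 < c + width m -> O o']
  else O c.-1 \/ c = n.

(** The guard keeps the truncated [x - 3] from sending 1 and 2 to the start 0. *)
Definition step_letter (x : nat) : bool := (3 <= x) && O (x - 3).

Lemma read_stateS (c : nat) (m : option nat) (x : nat) :
  0 < c -> read_state c m -> x < n -> ~~ seen c m x ->
  (forall y, y < n -> ~~ seen c m y -> v x <= v y) ->
  if step_letter x then x = (c + width m).+2 /\ read_state c (rise m)
  else x = c /\ exists2 m', fall m = Some m' & read_state (c + advance m) m'.
Proof.
move=> c0 st xn sx minx.
have far o o' : O o -> O o' -> o < o' -> o + 3 <= o'.
  by move=> /occO[h _] /occO[h' _]; exact: occ_at_far h h'.
case: m st sx minx => [h|]; last first.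
  rewrite /read_state /=.
  move=> [cO|->]; last by rewrite /seen /=; lia.
  move=> sx minx; have [_ cn] := occO cO.
  have x3 : x = c.-1.+3.
    apply/eqP; apply/negPn/negP => x3.
    have := @second_min _ x cO; have := minx c.-1.+3.
    by move: sx; rewrite /seen /=; lia.
  have -> : step_letter x.
    have e : x - 3 = c.-1 by lia.
    by rewrite /step_letter e cO andbT; lia.
  split; first lia.
  exists c.-1; split=> //; first lia.
  move=> o' h1 h2 h3; suff -> : o' = c.-1 by [].
  by move: h1 h2 h3 => /=; lia.
have hc : width (Some h) %% 3 != 1 by rewrite /=; lia.
have hu : 2 <= width (Some h) \/ h = 0 by rewrite /=; lia.
rewrite /seen [read_state _ _]/=; set wd := width (Some h) in hc hu *.
move=> [o [of1 oO pend]] sx minx.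
have [oocc on] := occO oO; move: oocc; rewrite occ_atE => /and4P[oo1 oo2 oo3 oo4].
(* Suppose [c < x < f]. If [x - 2] is congruent to [f], the occurrence there puts [x - 1] before
   [x]; otherwise the occurrence at [x - 4] puts [x - 2] before [x]. Either way an unread entry is
   smaller than that of [x]. *)
have xlow : x.+1 < c + wd -> x = c.
  move=> xf; apply/eqP; apply/negPn/negP => xc.
  have [e|e] : (c + wd - (x - 1)) %% 3 = 1 \/ (c + wd - (x - 2)) %% 3 = 1 by lia.
    have x1O : O (x - 1) by apply: pend; lia.
    (* The occurrence at 0 excludes starts at 1 and 2, so [x - 4] is a true difference. *)
    have x4 : 4 <= x.
      rewrite leqNgt; apply/negP => x4; have := far 0 (x - 1) O0 x1O; lia.
    have /occO[+ _] : O (x - 4) by apply: pend; lia.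
    rewrite occ_atE => /and4P[_ _ _].
    have -> : (x - 4).+2 = x - 2 by lia.
    have -> : (x - 2).+2 = x by lia.
    have := minx (x - 2); lia.
  have /occO[+ _] : O (x - 2) by apply: pend; lia.
  rewrite occ_atE => /and4P[_ _ + _].
  have -> : (x - 2).+1 = x - 1 by lia.
  have -> : (x - 1).+1 = x by lia.
  have := minx (x - 1); lia.
(* One of [c - 1], [c - 2] is a start, too close to [c - 3] for the latter to be one. *)
have lowbit : x = c -> c.+1 < c + wd -> step_letter x = false.
  move=> xc cf; apply/negP => /andP[x3 xO].
  have [e|e] : (c + wd - (c - 1)) %% 3 = 1 \/ (c + wd - (c - 2)) %% 3 = 1 by lia.
  - have h1 : O (c - 1) by apply: pend; lia.
    have := far (x - 3) (c - 1) xO h1; lia.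
  - have h1 : O (c - 2) by apply: pend; lia.
    have := far (x - 3) (c - 2) xO h1; lia.
have [xf|xf] := ltnP x.+1 (c + wd).
  have xc := xlow xf; rewrite lowbit //; last lia.
  split=> //; case: hu => [|h0]; last by move: xf; rewrite /wd h0 /=; lia.
  move: of1 pend; rewrite /wd; case: (h) => [|k] // of1 pend _.
  exists (Some k) => //; exists o; rewrite -addnA width_fall.
  by split=> // o' h1; apply: pend; lia.
have {xf} xo : o + 4 <= x by lia.
(* Here [f = o + 3]: the run continues if [f] is a start, and otherwise it closes. *)
have [fO|fO] := boolP (O o.+3).
  have [_ fn] := occO fO.
  have x6 : x = o + 6.
    apply/eqP; apply/negPn/negP => x6.
    have := @second_min _ x fO; have := minx o.+3.+3; lia.
  have -> : step_letter x.
    have e : x - 3 = o.+3 by lia.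
    by rewrite /step_letter e fO andbT; lia.
  split; first lia.
  exists o.+3; rewrite width_rise -/wd; split=> //; first lia.
  move=> o' h1 h2 h3.
  have [->//|h4] : o' = o.+3 \/ o'.+1 < c + wd by lia.
  by apply: pend; lia.
have next : O (o + 4) \/ o + 5 = n.
  by have := nextO oO; rewrite (negbTE fO) addn4 => /orP[/eqP|]; [right | left].
have x4 : x = o + 4.
  case: next => [fO'|]; last lia.
  apply/eqP; apply/negPn/negP => x4.
  have := @start_min _ x fO'; have := minx (o + 4); lia.
have -> : step_letter x = false.
  by apply/negP => /andP[_ /(far o)]; lia.
(* Otherwise [o + 2] is still unread and has a smaller entry than [o + 4]. *)
have h0 : h = 0.
  case: hu => // hu; have := minx o.+2; move: oo4; rewrite x4 addn4; lia.
have w0 : wd = 0 by rewrite /wd h0.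
rewrite h0; split; first lia.
exists None => //; rewrite /read_state /= addn1 /=.
have -> : c = o + 4 by lia.
by case: next => [|<-]; [left | right; lia].
Qed.

Lemma read_word (c : nat) (m : option nat) (D : seq nat) :
  0 < c -> read_state c m -> sorted (fun x y => v x < v y) D ->
  (forall x, (x \in D) = (x < n) && ~~ seen c m x) ->
  let w := map step_letter D in accepted m w /\ decode c m w = D.
Proof.
elim: D c m => [|x D IH] c m c0 st sD mD /=.
  split=> //; apply/negP => m1; move: st; rewrite /read_state m1.
  case=> o [co /occO[_ on] _]; have := mD (o + 4).
  by rewrite in_nil /seen; lia.
have minD : all (fun y => v x < v y) D.
  by apply: order_path_min sD => y x' z; exact: ltn_trans.
have [xn sx] : x < n /\ ~~ seen c m x.
  by apply/andP; rewrite -mD mem_head.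
have xD : x \notin D by apply/negP => /(allP minD); rewrite ltnn.
have minx y : y < n -> ~~ seen c m y -> v x <= v y.
  move=> yn sy; have : y \in x :: D by rewrite mD yn.
  by rewrite inE => /predU1P[->//|/(allP minD) /ltnW].
have mD' y : (y \in D) = [&& y < n, ~~ seen c m y & y != x].
  rewrite andbA -mD inE; case: eqP => [->|] //=; last by rewrite andbT.
  by rewrite (negbTE xD).
have sD' := path_sorted sD.
have := read_stateS c0 st xn sx minx; case: (step_letter x).
  case=> xE st'; have [|acc e] := IH c (rise m) c0 st' sD'.
    by move=> y; rewrite mD' seen_rise negb_or -xE.
  by rewrite /= e -xE.
case=> xE [m' fm st']; have [||acc e] := IH _ m' _ st' sD'.
- lia.
- by move=> y; rewrite mD' (seen_fall _ _ fm) negb_or -xE.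
- by rewrite /= fm /= e -xE.
Qed.

End ReadingWord.

(** * Permutations and the positions of their values *)

Section Order.
Variable n : nat.
Implicit Types (p : 'S_n) (L : seq nat).

Definition positions p : seq nat := [seq val (p^-1%g i) | i <- enum 'I_n].

Lemma pvalE p (i : 'I_n) : Defs.pval p i = p i.
Proof.
by rewrite /Defs.pval (nth_map i) ?size_enum_ord // nth_ord_enum.
Qed.

Lemma size_positions p : size (positions p) = n.
Proof. by rewrite size_map size_enum_ord. Qed.

Lemma nth_positions p (i : 'I_n) : nth 0 (positions p) (p i) = i.
Proof.
by rewrite (nth_map i) ?size_enum_ord // nth_ord_enum permK.
Qed.

Lemma positions_uniq p : uniq (positions p).
Proof.
by rewrite map_inj_uniq ?enum_uniq // => i j /val_inj /perm_inj.
Qed.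

Lemma mem_positions p x : (x \in positions p) = (x < n).
Proof.
apply/mapP/idP => [[i _ ->]|xn]; first exact: ltn_ord.
by exists (p (Ordinal xn)); rewrite ?mem_enum // permK.
Qed.

Lemma index_positions p x : x < n -> index x (positions p) = Defs.pval p x.
Proof.
move=> xn; have e := nth_positions p (Ordinal xn).
rewrite (pvalE p (Ordinal xn)) -{1}[x]e index_uniq ?positions_uniq //.
by rewrite size_positions.
Qed.

Lemma positions_inj : injective positions.
Proof.
move=> p p' e; apply/permP => i; apply/val_inj => /=.
by rewrite -!pvalE -!index_positions // e.
Qed.

Lemma positions_onto L : uniq L -> (forall x, (x \in L) = (x < n)) ->
  exists p, positions p = L.
Proof.
move=> uL mL.
have sL : size L = n.
  rewrite -(size_iota 0 n); apply/perm_size/uniq_perm; rewrite ?iota_uniq //.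
  by move=> x; rewrite mL mem_iota add0n.
have mLi (i : 'I_n) : val i \in L by rewrite mL ltn_ord.
have idx (i : 'I_n) : index (val i) L < n by have := mLi i; rewrite -index_mem sL.
have inj : injective (fun i => Ordinal (idx i)).
  move=> i j [] e; apply/val_inj.
  by rewrite -(nth_index 0 (mLi i)) e nth_index ?mLi.
exists (perm inj); apply: (@eq_from_nth _ 0).
  by rewrite size_positions sL.
move=> j; rewrite size_positions => jn.
have Ljn : nth 0 L j < n by rewrite -mL mem_nth ?sL.
have e : j = perm inj (Ordinal Ljn) by rewrite permE /= index_uniq ?sL.
by rewrite {1}e nth_positions.
Qed.

Lemma positions_sorted p :
  sorted (fun x y => Defs.pval p x < Defs.pval p y) (positions p).
Proof.
apply/(sortedP 0) => i; rewrite size_positions => i1.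
have i0 := ltnW i1.
rewrite -!index_positions -?(mem_positions p) ?mem_nth ?size_positions //.
by rewrite !index_uniq ?positions_uniq ?size_positions.
Qed.

Lemma is_occE p i : is_occ p i = (i + 5 <= n) && occ_at (Defs.pval p) i.
Proof.
rewrite /is_occ; congr andb; apply/forallP/idP => [h|].
  apply/allP => d /occ_stepsP hd.
  have lt a b (ha : a < 5) (hb : b < 5) :
      nth 0 sigma13425 a < nth 0 sigma13425 b -> Defs.pval p (i + a) < Defs.pval p (i + b).
    by move=> ab; have /forallP/(_ (Ordinal hb))/eqP -> := h (Ordinal ha).
  by case: hd => ->; apply: lt.
rewrite occ_atE => /and4P[h1 h2 h3 h4] a; apply/forallP => b.
by case: a b => [[|[|[|[|[|a]]]]] ha] [[|[|[|[|[|b]]]]] hb] //=;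
  rewrite ?addnS ?addn0; lia.
Qed.

End Order.

(** * The bijection between clusters and accepted words *)

Section Clusters.
Variable n : nat.
Implicit Types p : 'S_n.

Lemma mem_occs p i : (i \in occs p) = is_occ p i.
Proof.
rewrite mem_filter mem_iota add0n andbC /=.
by case: (ltnP i n) => // ni; rewrite is_occE; lia.
Qed.

Lemma occs_sorted p : sorted ltn (occs p).
Proof. by apply: sorted_filter (iota_ltn_sorted 0 n) => ? ? ?; exact: ltn_trans. Qed.

Lemma next_overlapping (a : nat) (s : seq nat) (o i : nat) :
  path ltn a s -> path (fun j j' => j' < j + pat_len) a s ->
  o \in a :: s -> i \in a :: s -> o < i ->
  exists2 o', o' \in a :: s & o < o' < o + 5.
Proof.
elim: s a => [|b s IH] a /=.
  by rewrite !inE => _ _ /eqP -> /eqP ->; rewrite ltnn.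
move=> /andP[ab sb] /andP[ab' sb'].
rewrite inE => /predU1P[-> _ _|os].
  by exists b; rewrite ?inE ?eqxx ?orbT ?ab.
rewrite inE => /predU1P[->|is_] oi; last first.
  by have [o' o's h] := IH b sb sb' os is_ oi; exists o'; rewrite // inE o's orbT.
have bo : b <= o.
  move: os; rewrite inE => /predU1P[->//|os]; apply: ltnW.
  by apply: (allP (order_path_min _ sb)) => // ? ? ?; exact: ltn_trans.
by have := ltn_trans (leq_ltn_trans bo oi) ab; rewrite ltnn.
Qed.

Lemma cluster_next p k o : is_cluster p k -> is_occ p o ->
  [|| o + 5 == n, is_occ p o.+3 | is_occ p o.+4].
Proof.
move=> /and3P[_ /forallP cov ov] oO.
have [occ on] : occ_at (Defs.pval p) o /\ o + 5 <= n.
  by move: oO; rewrite is_occE => /andP[].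
have n1 : n.-1 < n by lia.
have /hasP[i iO /= hi] := cov (Ordinal n1).
have /andP[iocc i5] : occ_at (Defs.pval p) i && (i + 5 <= n).
  by move: iO; rewrite mem_occs is_occE andbC.
case: (eqVneq (o + 5) n) => //= o5; have oi : o < i by rewrite /pat_len in hi; lia.
have so := occs_sorted p.
have {iO} : exists2 o', o' \in occs p & o < o' < o + 5.
  move: oO so ov iO; rewrite -mem_occs; case: (occs p) => // a s oO so ov iO.
  exact: next_overlapping so ov oO iO oi.
case=> o'; rewrite mem_occs => o'O oo'.
have occ' : occ_at (Defs.pval p) o' by move: o'O; rewrite is_occE => /andP[].
have := occ_at_far occ occ'.
have [e|[e|e]] : o' = o.+3 \/ o' = o.+4 \/ o' < o + 3 by lia.
- by rewrite -e o'O.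
- by rewrite -e o'O orbT.
- lia.
Qed.

(** Position 0 is read first in a cluster and carries no letter, so the word has length [n - 1] and
    decoding starts at [c = 1]. *)
Definition word_of p : seq bool := map (step_letter (is_occ p)) (behead (positions p)).

Lemma cluster_word p k : 0 < n -> is_cluster p k ->
  [/\ word_of p \in words n.-1 None, count id (word_of p) = k
    & 0 :: decode 1 None (word_of p) = positions p].
Proof.
move=> n0 cl; have nxt o := @cluster_next p k o cl.
have [/eqP sk /forallP cov _] := and3P cl.
have O0 : is_occ p 0.
  have /hasP[i iO /=] := cov (Ordinal n0).
  by rewrite leqn0 => /andP[/eqP i0 _]; rewrite -mem_occs -i0.
have occO o : is_occ p o -> occ_at (Defs.pval p) o /\ o + 5 <= n.
  by rewrite is_occE => /andP[].
have head0 : positions p = 0 :: behead (positions p).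
  have := mem_positions p 0; rewrite n0.
  have := positions_sorted p; case e : (positions p) => [|x D] //= sD.
  rewrite inE => /predU1P[<-//|D0].
  have : all (fun y => Defs.pval p x < Defs.pval p y) D.
    by apply: order_path_min sD => ? ? ?; exact: ltn_trans.
  move=> /allP/(_ 0 D0); have [->|x0] := posnP x; first by rewrite ltnn.
  have xn : x < n by rewrite -(mem_positions p) e mem_head.
  by have := start_min occO nxt O0 (x := x); lia.
have uD := positions_uniq p; rewrite head0 /= in uD; have [D0 uD'] := andP uD.
have [||||acc dec] := @read_word n _ _ occO nxt O0 1 None (behead (positions p)).
- by [].
- by left.
- by have := positions_sorted p; rewrite head0 /= => /path_sorted.
- move=> x; have := mem_positions p x; rewrite head0 /= inE.
  have -> : seen 1 None x = (x == 0) by rewrite /seen /=; lia.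
  by case: eqP => [->|_] /= <-; rewrite ?andbT ?andbF // (negbTE D0).
split.
- by rewrite mem_words acc andbT size_map size_behead size_positions.
- have -> : count id (word_of p) = count (step_letter (is_occ p)) (positions p).
    by rewrite head0 count_map.
  have : perm_eq (positions p) (iota 0 n).
    apply: uniq_perm; rewrite ?positions_uniq ?iota_uniq // => x.
    by rewrite mem_positions mem_iota.
  move/seq.permP => ->; rewrite -sk /occs size_filter.
  have n5 : 5 <= n by have [] := occO _ O0.
  have iotaE a b : a + b = n -> iota 0 n = iota 0 a ++ iota a b.
    by move=> e; rewrite -[in LHS]e iotaD.
  (* A letter [true] sits 3 after its start: the first three positions carry none, and the last
     three are too near the end to be starts. *)
  rewrite [in LHS](iotaE 3 (n - 3)); last lia.
  rewrite [in RHS](iotaE (n - 3) 3); last lia.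
  rewrite !count_cat [X in X + _ = _]/= (iotaDl 3 0) count_map.
  have -> : count (is_occ p) (iota (n - 3) 3) = 0.
    apply/eqP; rewrite -leqn0 leqNgt -has_count; apply/hasP => -[x].
    by rewrite mem_iota is_occE; lia.
  rewrite !add0n !addn0; apply: eq_count => x.
  by rewrite /= /step_letter addKn.
- by rewrite dec -head0.
Qed.

Lemma gap_path_le_last (a : nat) (s : seq nat) (o : nat) :
  path gap a s -> o \in a :: s -> o <= last a s.
Proof.
elim: s a => [|b s IH] a /=; first by rewrite inE => _ /eqP ->.
move=> /andP[ab sb]; rewrite inE => /predU1P[->|]; last exact: IH.
by have := gap_path_last sb; move: ab; rewrite /gap; lia.
Qed.

(** Every candidate start is within distance 2 of a start in the chain, so [occ_at_far] rules out
    additional occurrences. *)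
Lemma gap_path_near (a : nat) (s : seq nat) (i : nat) :
  path gap a s -> a <= i <= last a s ->
  exists2 o, o \in a :: s & [\/ i = o, i = o.+1, i = o.+2 | i.+1 = o].
Proof.
elim: s a => [|b s IH] a /=.
  by move=> _ h; exists a; rewrite ?mem_head //; constructor 1; lia.
move=> /andP[ab sb] ia; have [bi|ib] := leqP b i.
  have [|o os h] := IH b sb _; first lia.
  by exists o; rewrite // inE os orbT.
have [e|[e|[e|e]]] : i = a \/ i = a.+1 \/ i = a.+2 \/ i.+1 = b.
- by move: ab; rewrite /gap; lia.
- by exists a; rewrite ?mem_head //; constructor 1.
- by exists a; rewrite ?mem_head //; constructor 2.
- by exists a; rewrite ?mem_head //; constructor 3.
- by exists b; rewrite ?inE ?eqxx ?orbT //; constructor 4.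
Qed.

Lemma gap_path_cover (a : nat) (s : seq nat) (j : nat) :
  path gap a s -> a <= j < last a s + 5 ->
  has (fun i => i <= j < i + 5) (a :: s).
Proof.
elim: s a => [|b s IH] a /=; first by move=> _ ->.
move=> /andP[ab sb] ja; have [bj|jb] : b <= j \/ j < b by lia.
  by apply/orP; right; apply: (IH b sb); lia.
by move: ab; rewrite /gap; lia.
Qed.

Lemma chain_cluster p (s : seq nat) : path gap 0 s -> last 0 s + 5 = n ->
  (forall o, o \in 0 :: s -> occ_at (Defs.pval p) o) -> is_cluster p (size (0 :: s)).
Proof.
move=> gs ls occ.
have ss : sorted ltn (0 :: s).
  by apply: sub_path gs => x y; rewrite /gap /=; lia.
have eO : occs p = 0 :: s.
  apply: (irr_sorted_eq ltn_trans ltnn) => //; first exact: occs_sorted.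
  move=> i; rewrite mem_occs is_occE; apply/andP/idP => [[i5 occi]|io]; last first.
    by rewrite occ //; have := gap_path_le_last gs io; lia.
  have [|o os h] := gap_path_near gs (i := i); first lia.
  have occo := occ o os.
  have [lt|lt|-> //] := ltngtP i o.
    by have := occ_at_far occi occo lt; case: h; lia.
  by have := occ_at_far occo occi lt; case: h; lia.
apply/and3P; split; first by rewrite eO.
  apply/forallP => j; rewrite eO; apply: gap_path_cover gs _.
  by have := ltn_ord j; lia.
by rewrite eO; apply: sub_path gs => x y; rewrite /gap /pat_len; lia.
Qed.

Lemma word_cluster (w : seq bool) : 1 < n -> w \in words n.-1 None ->
  exists2 p : 'S_n, is_cluster p (count id w) & 0 :: decode 1 None w = positions p.
Proof.
move=> n1; rewrite mem_words => /andP[/eqP sw acc].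
have [||N [uD mD cD]] := @decode_spec 1 None w _ _ acc => //.
have seen1 x : seen 1 None x = (x == 0) by rewrite /seen /=; lia.
set D := decode 1 None w in uD mD *.
have D0 : 0 \notin D by rewrite mD seen1 andbF.
have uL : uniq (0 :: D) by rewrite /= D0.
have N0 : 0 < N by case: cD => [[_ <-]//|[o [s [_ _ _ <-]]]]; lia.
have mL x : (x \in 0 :: D) = (x < N).
  by rewrite inE mD seen1; case: eqP => [->|] //=; rewrite andbT.
have NE : N = n.
  have : perm_eq (0 :: D) (iota 0 N).
    by apply: uniq_perm; rewrite ?iota_uniq // => x; rewrite mL mem_iota.
  by move/perm_size; rewrite size_iota /= size_decode sw; lia.
rewrite NE in mL cD.
have [p pE] := positions_onto uL mL; exists p; last by [].
case: cD => [[_ h]|[_ [s [[->] sE gs ls]]]]; first lia.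
rewrite -(size_starts 1 None w) sE; apply: chain_cluster => // o os.
apply/allP => d hd.
have on : o + 4 < n by have := gap_path_le_last gs os; lia.
have d4 : (o + d.1 < n) /\ (o + d.2 < n) /\ o + d.1 != o + d.2 /\ 0 < d.2.
  by case/occ_stepsP: hd => ->; split; rewrite /=; lia.
case: d4 => h1 [h2 [h3 h4]].
rewrite -!index_positions // pE.
have : precedes (0 :: D) (o + d.1) (o + d.2).
  apply: precedes_cons => //; first by lia.
  by apply: decode_precedes; rewrite ?sE ?os ?orbT.
by rewrite /precedes !mL h1 h2.
Qed.

End Clusters.

Lemma card_clusters (n k : nat) : 1 < n ->
  #|[set p : 'S_n | is_cluster p k]|
  = count (fun w => count id w == k) (words n.-1 None).
Proof.
move=> n1; have n0 := ltnW n1.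
rewrite cardE -(size_map (@word_of n)) -size_filter.
apply/perm_size/uniq_perm; last 1 first.
- move=> w; rewrite mem_filter; apply/mapP/andP => [[p]|[/eqP kw ww]].
    rewrite mem_enum inE => /(cluster_word n0)[ww kw _] ->.
    by rewrite kw eqxx.
  have [p cl wp] := word_cluster n1 ww; rewrite kw in cl.
  exists p; first by rewrite mem_enum inE.
  have [_ _ wp'] := cluster_word n0 cl.
  by move: wp; rewrite -wp' => -[] /decode_inj.
- rewrite map_inj_in_uniq ?enum_uniq // => p p'.
  rewrite !mem_enum !inE => /(cluster_word n0)[_ _ e] /(cluster_word n0)[_ _ e'] w.
  by apply: positions_inj; rewrite -e -e' w.
- exact: filter_uniq (uniq_words _ _).
Qed.

End Combinatorics.

(** * Signed cluster numbers as walks *)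

Definition sum_seq (A : Type) (g : A -> R) (s : seq A) : R :=
  foldr (fun a r => g a + r) 0 s.

Lemma sum_seq_cat (A : Type) (g : A -> R) (s s' : seq A) :
  sum_seq g (s ++ s') = sum_seq g s + sum_seq g s'.
Proof. by elim: s => [|a s IH] /=; rewrite ?IH; ring. Qed.

Lemma sum_by_count (A : Type) (c : A -> nat) (s : seq A) (N : nat) :
  all (fun a => c a <= N)%N s ->
  sum_f_R0 (fun k => (-1) ^ k * INR (count (fun a => c a == k) s)) N
  = sum_seq (fun a => (-1) ^ c a) s.
Proof.
elim: s => [_|a s IH /= /andP[aN /IH <-]].
  by apply: sum_eq_R0 => k _ /=; ring.
have single : sum_f_R0 (fun k => (-1) ^ k * INR (c a == k)) N = (-1) ^ c a.
  elim: N aN {IH} => [|N IH]; first by rewrite leqn0 => /eqP -> /=; ring.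
  rewrite leq_eqVlt tech5 => /predU1P[->|aN].
    rewrite eqxx (sum_eq_R0 _ N) /= => [|k kN]; first by ring.
    have -> : (N.+1 == k) = false by lia.
    by rewrite /=; ring.
  rewrite IH //; have -> : (c a == N.+1) = false by lia.
  by rewrite /=; ring.
rewrite -single -sum_plus; apply: PartSum.sum_eq => k _.
by rewrite plus_INR; ring.
Qed.

Lemma sum_words (n : nat) (m : option nat) :
  sum_seq (fun w => (-1) ^ count id w) (words n m) = cluster_walks n m.
Proof.
have sum_cons b s : sum_seq (fun w => (-1) ^ count id w) (map (cons b) s)
    = (-1) ^ b * sum_seq (fun w => (-1) ^ count id w) s.
  by elim: s => [|w s /= ->]; rewrite /= ?pow_add; ring.
rewrite /cluster_walks; elim: n m => [|n IH] m; first by case: m => [h|] /=; ring.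
rewrite /= sum_seq_cat sum_cons IH.
by case: (fall m) => [m'|] /=; rewrite ?sum_cons ?IH /=; ring.
Qed.

Lemma Tcoef_walks (n : nat) : Tcoef n.+1 = cluster_walks n None.
Proof.
(* For lengths below 5 the conventional values of [s_nk] agree with the walks by computation. *)
have [n4|n4] := leqP 4 n; last first.
  case: n n4 => [|[|[|[|n]]]] // _; rewrite /Tcoef /t_n /s_nk /cluster_walks /=; ring.
rewrite -sum_words -[RHS](@sum_by_count _ _ _ n.+1).
  apply: PartSum.sum_eq => k _; rewrite /s_nk; case: ifP => [h|_]; first by move: h; rewrite /pat_len; lia.
  by rewrite card_clusters //; lia.
apply/allP => w; rewrite mem_words => /andP[/eqP <- _].
by apply: leqW; apply: count_size.
Qed.

Lemma is_series_cluster_walks (x : R) (hx : 0 < x < / 2) :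
  is_series (fun n => cluster_walks n None * x ^ n) (/ (1 + x - Ffun x)).
Proof.
have [h1 h2 h3] : [/\ 0 < Ffun x, Ffun x <= x & x * Ffun x ^ 3 + Ffun x = x].
  by split; [apply: Ffun_gt0 | apply: Ffun_le | apply: Ffun_cubic]; lra.
move: (Ffun x) h1 h2 h3 => F h1 h2 h3.
(* From height [h], [h + 1] first passages down, each contributing [F], lead to the state [None];
   the last one closes the run. *)
pose V m := (if m is Some h then F ^ h.+1 else 1) / (1 + x - F).
have -> : / (1 + x - F) = V None by rewrite /V; field; lra.
apply: (is_series_walks (B := 1)) => // [m|[[|h]|]] /=.
- have Fm : 0 <= (if m is Some h then F ^ h.+1 else 1) <= 1.
    case: m => [h|]; last lra.
    split; first by apply: pow_le; lra.
    by rewrite -(pow1 h.+1); apply: pow_incr; lra.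
  rewrite /V Rabs_pos_eq; first by apply/Rle_div_l; lra.
  by apply: Rle_mult_inv_pos; lra.
- by rewrite /V /=; field_simplify_eq; [nra | lra].
- rewrite /V /=; field_simplify_eq; last lra.
  have -> : F ^ 2 * F ^ h = (x * F ^ 3 + F) * F * F ^ h - x * F ^ 4 * F ^ h by ring.
  by rewrite h3; ring.
- by rewrite /V /=; field_simplify_eq; [nra | lra].
Qed.

(** * The cubic equation for [T(x)] and the conclusion *)

Definition cubic_coef (k i : nat) : Z :=
  nth 0%Z (nth [::] [:: [:: -1; -2; -6; -12; -8];
                        [:: 3; 5; 15; 24; 12];
                        [:: -3; -4; -12; -15; -6];
                        [:: 1; 1; 3; 3; 1]]%Z k) i.

(* With [y = T(x)] one has [F(x) = 1 + x - x / (y - 1)]; the cubic is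
   [x F^3 + F - x = 0] multiplied by [(y - 1)^3]. *)
Lemma cubic_coefE (x y : R) :
  sum_f_R0 (fun k => sum_f_R0 (fun i => IZR (cubic_coef k i) * x ^ i) 4 * y ^ k) 3
  = x * ((1 + x) * y - (1 + 2 * x)) ^ 3 + (y - 1) ^ 3 - x * (y - 1) ^ 2.
Proof. rewrite /cubic_coef /=; ring. Qed.

Theorem theorem3p2 :
  exists delta : R, 0 < delta /\
  (* T(x) = (1 + 2x - F(x)) / (1 + x - F(x)) near 0 (series converges) *)
  (forall x : R, 0 < x < delta ->
     ex_series (fun n => Tcoef n * x ^ n) /\
     1 + x - Ffun x <> 0 /\
     Tval x = (1 + 2 * x - Ffun x) / (1 + x - Ffun x)) /\
  (* F(x) is a power series in x with F(x) = x + O(x^4) *)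
  (exists f : nat -> R,
     f 0%nat = 0 /\ f 1%nat = 1 /\ f 2%nat = 0 /\ f 3%nat = 0 /\
     forall x : R, 0 < x < delta -> is_series (fun n => f n * x ^ n) (Ffun x)) /\
  (* T(x) is a root of a cubic P(x, y) = sum_{k<=3} sum_{i<=d} c k i x^i y^k
     with integer coefficients and nonzero leading coefficient in y *)
  (exists (c : nat -> nat -> Z) (d : nat),
     (forall k i : nat, (3 < k)%nat \/ (d < i)%nat -> c k i = 0%Z) /\
     (exists i : nat, c 3%nat i <> 0%Z) /\
     forall x : R, 0 < x < delta ->
       sum_f_R0 (fun k => sum_f_R0 (fun i => IZR (c k i) * x ^ i) d * Tval x ^ k) 3
       = 0).
Proof.
have D0 x : 0 < x < / 2 -> 1 + x - Ffun x <> 0.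
  by move=> hx; have := @Ffun_le x; lra.
have serT x : 0 < x < / 2 ->
    is_series (fun n => Tcoef n * x ^ n) ((1 + 2 * x - Ffun x) / (1 + x - Ffun x)).
  (* Removing the constant term leaves [x / (1 + x - F)], since [Tcoef n.+1] is given by walks of
     [n] steps. *)
  move=> hx; apply: is_series_decr_1; rewrite /plus /opp /=.
  have -> : (1 + 2 * x - Ffun x) / (1 + x - Ffun x) + - (1 * 1)
            = scal x (/ (1 + x - Ffun x)).
    by rewrite /scal /= /mult /=; field; exact: D0.
  apply: (is_series_ext (fun n => scal x (cluster_walks n None * x ^ n))).
    by move=> n; rewrite -Tcoef_walks /scal /= /mult /=; ring.
  by apply: is_series_scal; apply: is_series_cluster_walks.
have TvalE x : 0 < x < / 2 ->
    Tval x = (1 + 2 * x - Ffun x) / (1 + x - Ffun x).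
  by move=> hx; apply: is_series_unique; apply: serT.
(* The radius comes from the contraction factor [2 * x], which must be below 1. *)
exists (/ 2); split; first lra; split; last split.
- move=> x hx; split; first by eexists; exact: serT.
  by split; [exact: D0 | exact: TvalE].
- exists Fcoef; split; [by [] | split; [by [] | split; [|split]]].
  + by rewrite /= ; ring.
  + by rewrite /= ; ring.
  + by move=> x; apply: is_series_Fcoef.
- exists cubic_coef, 4%N; split; last split.
  + move=> k i h; rewrite /cubic_coef.
    case: h => [h|h]; first by rewrite (nth_default [::]) ?nth_nil //; lia.
    by case: k => [|[|[|[|k]]]] /=; rewrite ?nth_nil // nth_default //=; lia.
  + by exists 0%N.
  + move=> x hx; rewrite cubic_coefE TvalE //.
    have h3 : x * Ffun x ^ 3 + Ffun x = x by apply: Ffun_cubic; lra.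
    have hD := D0 x hx; move: (Ffun x) h3 hD => F h3 hD.
    set D := 1 + x - F in hD *.
    have -> : (1 + 2 * x - F) / D = 1 + x / D by rewrite /D; field; exact: hD.
    have -> : (1 + x) * (1 + x / D) - (1 + 2 * x) = x * F / D.
      by rewrite /D; field; exact: hD.
    have -> : x * (x * F / D) ^ 3 + (1 + x / D - 1) ^ 3 - x * (1 + x / D - 1) ^ 2
              = x ^ 3 / D ^ 3 * (x * F ^ 3 + F - x).
      by rewrite /D; field; exact: hD.
    by rewrite h3; ring.
Qed.
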